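(* Let $\alpha$ and $\beta$ be non-zero complex numbers. Assume that $m\alpha+n\beta\neq 0$ for all positive integers $m$ and $n$. Then the only pair $(p,q)$ of non-zero monic polynomials $p,q\in\mathbb{C}[u]$ satisfying $$p(u)q(u)=p(u+\beta)q(u+\alpha)$$ is the trivial solution $(p,q)=(1,1)$.
   Context: $\mathbb{C}[u]$ denotes the algebra of complex polynomials in one indeterminate $u$. *)

(* Defs.v *)
From mathcomp Require Import all_boot all_order all_algebra.
From mathcomp Require Import reals.
From mathcomp Require Import complex.

Set Implicit Arguments.
Unset Strict Implicit.
Unset Printing Implicit Defensive.

Import GRing.Theory.
Local Open Scope ring_scope.

(* p(u + a) *)
Definition poly_shift (K : comNzRingType) (a : K) (p : {poly K}) : {poly K} :=
  p \Po ('X + a%:P).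

(* Main.v *)
(** Comparing the sums of the roots (with multiplicity) of the two sides gives
    [deg p * beta + deg q * alpha = 0]. Non-resonance forbids this when both
    degrees are positive, and since [alpha] and [beta] are nonzero, if one
    degree vanishes then so does the other. *)
Require Import Defs.
From mathcomp Require Import all_boot all_order all_algebra.
From mathcomp Require Import reals.
From mathcomp Require Import complex.

Set Implicit Arguments.
Unset Strict Implicit.
Unset Printing Implicit Defensive.

Import GRing.Theory.
Local Open Scope ring_scope.
Local Open Scope complex_scope.

Lemma poly_shift_prod_XsubC (K : comNzRingType) (a : K) (rs : seq K) :
  poly_shift a (\prod_(x <- rs) ('X - x%:P)) =
  \prod_(x <- [seq x - a | x <- rs]) ('X - x%:P).
Proof.
rewrite /poly_shift rmorph_prod big_map; apply: eq_bigr => x _ /=.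
by rewrite comp_polyB comp_polyX comp_polyC polyCB opprB addrA.
Qed.

Lemma monic_closed_prod_XsubC (K : closedFieldType) (p : {poly K}) :
  p \is monic -> {rs : seq K | p = \prod_(x <- rs) ('X - x%:P)}.
Proof.
move=> /monicP p_monic; have [rs def_p] := closed_field_poly_normal p.
by exists rs; rewrite {1}def_p p_monic scale1r.
Qed.

Lemma sum_translate (V : zmodType) (a : V) (rs : seq V) :
  \sum_(x <- [seq x - a | x <- rs]) x = \sum_(x <- rs) x - a *+ size rs.
Proof.
by rewrite big_map sumrB big_const_seq count_predT iter_addr_0.
Qed.

(** Unique factorization makes the root lists of both sides permutations of each other, so their
    sums agree; shifting by [a] lowers each root by [a]. *)
Lemma shift_eq_degrees (K : fieldType) (alpha beta : K) (rs ss : seq K)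
    (p := \prod_(x <- rs) ('X - x%:P)) (q := \prod_(x <- ss) ('X - x%:P)) :
  p * q = poly_shift beta p * poly_shift alpha q ->
  (size ss)%:R * alpha + (size rs)%:R * beta = 0.
Proof.
rewrite !poly_shift_prod_XsubC -!big_cat /= => /prod_XsubC_eq eq_roots.
have /(_ 0) := perm_big (op := +%R) (P := xpredT) (F := id) _ eq_roots.
rewrite !big_cat /= !sum_translate.
(* The equation reads [S = S - T], with [S] the sum of all roots; cancelling [S] leaves [T = 0]. *)
rewrite addrACA -opprD => /eqP; rewrite -subr_eq0 subKr => /eqP.
by rewrite !mulr_natl addrC.
Qed.

Theorem theorem4p10 (R : realType) (alpha beta : R[i])
  (alpha_neq0 : alpha != 0) (beta_neq0 : beta != 0)
  (nonresonant : forall m n : nat, (0 < m)%N -> (0 < n)%N ->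
     m%:R * alpha + n%:R * beta != 0)
  (p q : {poly R[i]}) (p_monic : p \is monic) (q_monic : q \is monic) :
  p * q = poly_shift beta p * poly_shift alpha q <-> (p, q) = (1, 1).
Proof.
split=> [|[-> ->]]; last by rewrite /poly_shift !rmorph1 mulr1.
have [rs ->] := monic_closed_prod_XsubC p_monic.
have [ss ->] := monic_closed_prod_XsubC q_monic.
move=> /shift_eq_degrees; case: rs ss => [|r rs] [|s ss].
- by rewrite !big_nil.
(* Here [p = 1] and [q] is not constant: a positive multiple of [alpha] would vanish, impossible in
   characteristic zero. *)
- move/eqP; rewrite mul0r addr0 mulf_eq0 (negPf alpha_neq0) orbF.
  by rewrite Num.Theory.pnatr_eq0.
- move/eqP; rewrite mul0r add0r mulf_eq0 (negPf beta_neq0) orbF.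
  by rewrite Num.Theory.pnatr_eq0.
(* The roles cross: [m] is the degree of [q], and [n] that of [p]. *)
- move=> resonant; have := nonresonant (size (s :: ss)) (size (r :: rs)) isT isT.
  by rewrite resonant eqxx.
Qed.
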